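(* Let $K$ be a field of prime characteristic $p$ and let $L/K$ be a finite field extension. Then $$L\rtimes G(L/K)=L^{G(L/K)}\otimes_{L^{G(L/K)}_{dif}}\Big(L_{dif}\rtimes G\big(L_{dif}/L^{G(L/K)}_{dif}\big)\Big).$$
   Context: For a finite field extension $L/K$: $E(L/K)=\mathrm{End}_K(L)$; $L$ is viewed as a subfield of $E(L/K)$ via multiplication operators. $G(L/K)=\mathrm{Aut}_{K\text{-alg}}(L)\subseteq E(L/K)$ and $L^{G(L/K)}$ is its fixed field. $L\rtimes G(L/K)=\bigoplus_{g\in G(L/K)}Lg\subseteq E(L/K)$ is the skew group algebra (the subalgebra generated by $L$ and $G(L/K)$), with $gl=g(l)g$; the same notation is used for other finite extensions. $\mathcal{D}(L/K)=\bigcup_{i\ge0}\mathcal{D}_i\subseteq E(L/K)$ is the algebra of $K$-linear differential operators on $L$, where $\mathcal{D}_0=L$ and $\mathcal{D}_i=\{\delta\in E(L/K)\mid\delta l-l\delta\in\mathcal{D}_{i-1}\text{ for all }l\in L\}$. $L_{dif}=\{l\in L\mid l\delta=\delta l\text{ for all }\delta\in\mathcal{D}(L/K)\}$ and $L^{G(L/K)}_{dif}:=L^{G(L/K)}\cap L_{dif}$. For every finite extension of characteristic $p$, the multiplication map identifies $L=L^{G(L/K)}\otimes_{F}L_{dif}$ with $F=L^{G(L/K)}_{dif}$, so that $E(L/F)=E(L^{G(L/K)}/F)\otimes_F E(L_{dif}/F)$, and the right hand side of the claim is regarded as a subalgebra of $E(L/F)\subseteq E(L/K)$; the group $G(L/K)$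 is identified with $G(L_{dif}/F)$ by restriction, an automorphism of $L_{dif}/F$ acting on $L$ trivially on the factor $L^{G(L/K)}$. *)

(* Defs.v *)
From HB Require Import structures.
From mathcomp Require Import all_boot all_order all_fingroup all_algebra.
From mathcomp Require Import all_solvable all_field.
From mathcomp Require Import boolp.

Set Implicit Arguments.
Unset Strict Implicit.
Unset Printing Implicit Defensive.

Import GRing.Theory.
Local Open Scope ring_scope.

(** * Subfields of a finite extension cut out by a proposition *)

Section Comprehension.
Variables (K : fieldType) (L : fieldExtType K).

Definition subfield_closed (P : L -> Prop) : Prop :=
  [/\ P 1, forall (a : K) x y, P x -> P y -> P (a *: x + y)
    & forall x y, P x -> P y -> P (x * y)].

Lemma vspace_of_pred (P : L -> Prop) :
    P 0 -> (forall (a : K) x y, P x -> P y -> P (a *: x + y)) ->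
  exists U : {vspace L}, forall x, x \in U <-> P x.
Proof.
move=> P0 PD.
pose sub (U : {vspace L}) := forall x, x \in U -> P x.
pose ok n := `[< exists2 U, sub U & \dim U = n >].
have ok0 : exists n, ok n.
  exists 0%N; apply/asboolP; exists 0%VS; last exact: dimv0.
  by move=> x; rewrite memv0 => /eqP->.
have okB n : ok n -> (n <= \dim {:L})%N.
  by case/asboolP=> U _ <-; rewrite dimvS ?subvf.
case: (ex_maxnP ok0 okB) => n /asboolP[U sU dU] maxn; exists U => x.
split=> [/sU //|Px]; apply: contraT => Ux.
have sU' : sub (<[x]> + U)%VS.
  move=> _ /memv_addP[_ /vlineP[a ->] [y /sU Py ->]]; exact: PD.
have /maxn : ok (\dim (<[x]> + U)%VS) by apply/asboolP; exists (<[x]> + U)%VS.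
rewrite -dU leqNgt => /negP[].
rewrite ltnNge; apply: contra Ux => le_dim.
have /eqP -> : (U == <[x]> + U)%VS by rewrite eqEdim addvSr le_dim.
by rewrite memvE addvSl.
Qed.

Lemma subfield_of_pred (P : L -> Prop) :
  subfield_closed P -> exists U : {subfield L}, forall x, x \in U <-> P x.
Proof.
case=> P1 PD PM.
have P0 : P 0 by have := PD (-1) 1 1 P1 P1; rewrite scaleN1r addNr.
have [U UP] := vspace_of_pred P0 PD.
have algU : is_aspace U.
  rewrite /is_aspace has_algid1; last by apply/UP.
  by apply/prodvP=> x y /UP Px /UP Py; apply/UP/PM.
by exists (ASpace algU).
Qed.

Definition subfield_of (P : L -> Prop) (Pcl : subfield_closed P) :
  {subfield L} := sval (cid (subfield_of_pred Pcl)).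

Lemma mem_subfield_of (P : L -> Prop) (Pcl : subfield_closed P) x :
  x \in subfield_of Pcl <-> P x.
Proof. exact: (svalP (cid (subfield_of_pred Pcl))). Qed.

End Comprehension.

(** * The algebra of K-linear endomorphisms of L

    E(L/K) is ['End(L)], its product is the composition [\o] of [lfun_scope],
    and the multiplication operator of [l] is [amull l]. *)

Section Endomorphisms.
Variables (K : fieldType) (L : fieldExtType K).

Definition is_aut : pred 'End(L) := [pred g | kAut 1 {:L} g].

Lemma fixed_closed :
  subfield_closed (fun l : L => forall g, is_aut g -> g l = l).
Proof.
split=> [g /andP[/kHom_monoid_morphism[g1 _] _] //
  | a x y gx gy g g_aut | x y gx gy g g_aut].
  by rewrite linearD linearZ /= (gx g g_aut) (gy g g_aut).
have /andP[/kHom_monoid_morphism[_ gM] _] := g_aut.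
by rewrite gM gx ?gy.
Qed.

Definition fixed_field : {subfield L} := subfield_of fixed_closed.

Lemma mem_fixed_field l :
  l \in fixed_field <-> forall g, is_aut g -> g l = l.
Proof. exact: mem_subfield_of. Qed.

(* [diffop_le i] is D_i *)
Fixpoint diffop_le (i : nat) (d : 'End(L)) : Prop :=
  if i is j.+1 then
    forall l : L, diffop_le j ((d \o amull l) - (amull l \o d))%VF
  else exists l : L, d = amull l.

Definition diffop (d : 'End(L)) : Prop := exists i, diffop_le i d.

Lemma dif_closed : subfield_closed (fun l : L =>
  forall d, diffop d -> (amull l \o d = d \o amull l)%VF).
Proof.
split=> [d _ | a x y cx cy d Dd | x y cx cy d Dd].
- by apply/lfunP=> z; rewrite !lfunE /= !lfunE /= !mul1r.
- have ex z : x * d z = d (x * z).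
    by have /lfunP/(_ z) := cx d Dd; rewrite !lfunE /= !lfunE.
  have ey z : y * d z = d (y * z).
    by have /lfunP/(_ z) := cy d Dd; rewrite !lfunE /= !lfunE.
  apply/lfunP=> z; rewrite !lfunE /= !lfunE /= !mulrDl -!scalerAl.
  by rewrite linearP ex ey.
- have ex z : x * d z = d (x * z).
    by have /lfunP/(_ z) := cx d Dd; rewrite !lfunE /= !lfunE.
  have ey z : y * d z = d (y * z).
    by have /lfunP/(_ z) := cy d Dd; rewrite !lfunE /= !lfunE.
  by apply/lfunP=> z; rewrite !lfunE /= !lfunE /= -!mulrA ey ex.
Qed.

Definition dif_field : {subfield L} := subfield_of dif_closed.

Lemma mem_dif_field l : l \in dif_field <->
  forall d, diffop d -> (amull l \o d = d \o amull l)%VF.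
Proof. exact: mem_subfield_of. Qed.

Definition fixed_dif_field : {subfield L} := (fixed_field :&: dif_field)%AS.

(* Membership in the sum of the subspaces L g of E(L/K), g in G(L/K), which is
   the subalgebra generated by L and G(L/K).  The sum is direct by Dedekind's
   independence of automorphisms. *)
Definition skew_alg (d : 'End(L)) : Prop :=
  exists2 s : seq (L * 'End(L)), all (fun u => is_aut u.2) s
    & d = (\sum_(u <- s) (amull u.1 \o u.2))%VF.

End Endomorphisms.

(** * Tensor products of finite-dimensional vector spaces

    [tensor U V] is the space of matrices of coordinates in the basis
    (e_i (x) f_j), for the library bases (e_i) of U and (f_j) of V; the lemmas
    [tens_liftE] and [tens_hom_eq] are the universal property. *)

Section Tensor.
Variables (F : fieldType).
Implicit Types U V W : vectType F.

Definition tensor U V : vectType F := 'M[F]_(\dim {:U}, \dim {:V}).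

Definition tens U V (u : U) (v : V) : tensor U V :=
  \matrix_(i, j) (coord (vbasis {:U}) i u * coord (vbasis {:V}) j v).

Definition tens_lift_fun U V W (b : U -> V -> W) (t : tensor U V) : W :=
  \sum_i \sum_j (t : 'M_(_, _)) i j *: b (vbasis {:U})`_i (vbasis {:V})`_j.

Definition tens_lift U V W (b : U -> V -> W) : 'Hom(tensor U V, W) :=
  linfun (tens_lift_fun b).

Definition tens_map U V (phi : 'End(U)) (psi : 'End(V)) : 'End(tensor U V) :=
  tens_lift (fun u v => tens (phi u) (psi v)).

Lemma tens_lift_fun_linear U V W (b : U -> V -> W) : linear (tens_lift_fun b).
Proof.
move=> a s t; rewrite /tens_lift_fun scaler_sumr -big_split.
apply: eq_bigr => i _; rewrite scaler_sumr -big_split.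
by apply: eq_bigr => j _; rewrite !mxE scalerDl scalerA.
Qed.

HB.instance Definition _ U V W (b : U -> V -> W) :=
  GRing.isLinear.Build F (tensor U V) W _ (tens_lift_fun b)
    (tens_lift_fun_linear b).

Lemma tens_liftE U V W (b : U -> V -> W) :
    (forall v, linear (b^~ v)) -> (forall u, linear (b u)) ->
  forall u v, tens_lift b (tens u v) = b u v.
Proof.
move=> lb rb u v; rewrite lfunE /= /tens_lift_fun.
have lS v' I (r : seq I) (a : I -> F) x :
    b (\sum_(i <- r) a i *: x i) v' = \sum_(i <- r) a i *: b (x i) v'.
  elim: r => [|i r IHr]; last by rewrite !big_cons lb IHr.
  by rewrite !big_nil; have := lb v' (-1) 0 0; rewrite !scaleN1r !addNr.
have rS u' I (r : seq I) (a : I -> F) x :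
    b u' (\sum_(i <- r) a i *: x i) = \sum_(i <- r) a i *: b u' (x i).
  elim: r => [|i r IHr]; last by rewrite !big_cons rb IHr.
  by rewrite !big_nil; have := rb u' (-1) 0 0; rewrite !scaleN1r !addNr.
rewrite [in RHS](coord_vbasis (memvf u)) lS; apply: eq_bigr => i _.
rewrite [in RHS](coord_vbasis (memvf v)) rS scaler_sumr; apply: eq_bigr => j _.
by rewrite mxE scalerA.
Qed.

Lemma tens_hom_eq U V W (f g : 'Hom(tensor U V, W)) :
  (forall u v, f (tens u v) = g (tens u v)) -> f = g.
Proof.
move=> fg; apply/lfunP=> t.
have -> : t = \sum_i \sum_j (t : 'M_(_, _)) i j *:
    tens (vbasis {:U})`_i (vbasis {:V})`_j.
  rewrite [LHS]matrix_sum_delta; apply: eq_bigr => i _; apply: eq_bigr => j _.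
  congr (_ *: _); apply/matrixP=> k l.
  by rewrite !mxE !coord_free ?(basis_free (vbasisP _)) // -natrM mulnb
    [k == i]eq_sym [l == j]eq_sym.
rewrite !linear_sum; apply: eq_bigr => i _.
rewrite !linear_sum; apply: eq_bigr => j _.
by rewrite !linearZ /= fg.
Qed.

Lemma tens_linearl U V (v : V) : linear (fun u : U => tens u v).
Proof. by move=> a x y; apply/matrixP=> i j; rewrite !mxE linearP mulrDl mulrA. Qed.

Lemma tens_linearr U V (u : U) : linear (tens (V := V) u).
Proof. by move=> a x y; apply/matrixP=> i j; rewrite !mxE linearP mulrDr mulrCA. Qed.

Lemma tens_mapE U V (phi : 'End(U)) (psi : 'End(V)) u v :
  tens_map phi psi (tens u v) = tens (phi u) (psi v).
Proof.
apply: (@tens_liftE U V _ (fun u v => tens (phi u) (psi v))) => [v'|u'] a x y.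
  by rewrite linearP tens_linearl.
by rewrite linearP tens_linearr.
Qed.

End Tensor.

(** * The decomposition L = L^G (x)_F L_dif, where F is the intersection *)

Section Decomposition.
Variables (K : fieldType) (L : fieldExtType K).

Let F : {subfield L} := fixed_dif_field L.

(* L, L^G and L_dif as finite extensions of F; [aspaceOver F E] is F * E, which
   is E here since F is contained in both subfields. *)
Definition L_over : fieldExtType (subvs_of F) := fieldOver F.
Definition fixed_over : fieldExtType (subvs_of F) :=
  subvs_of (aspaceOver F (fixed_field L)).
Definition dif_over : fieldExtType (subvs_of F) :=
  subvs_of (aspaceOver F (dif_field L)).

Definition mul_map : 'Hom(tensor fixed_over dif_over, L_over) :=
  tens_lift (fun (a : fixed_over) (b : dif_over) => vsval a * vsval b).

(* phi (x) psi as an element of E(L/F), transported along [mul_map]; the inverse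
   [mul_map^-1] is genuine as soon as [mul_map] is bijective. *)
Definition tens_end (phi : 'End(fixed_over)) (psi : 'End(dif_over)) :
  'End(L_over) := (mul_map \o tens_map phi psi \o mul_map^-1)%VF.

(* Membership in the image in E(L/F) of L^G (x)_F (L_dif >< G(L_dif/F)). *)
Definition fixed_tens_skew (d : 'End(L_over)) : Prop :=
  exists2 s : seq (fixed_over * 'End(dif_over)),
      forall u, u \in s -> skew_alg u.2
    & d = \sum_(u <- s) tens_end (amull u.1) u.2.

(* The inclusion of E(L/F) in E(L/K). *)
Definition end_over_incl (d : 'End(L_over)) : 'End(L) :=
  linfun (fun x : L => (d (x : L_over) : L)).

Lemma end_over_inclE (d : 'End(L_over)) (x : L) : end_over_incl d x = d x.
Proof.
have d_lin : linear (fun y : L => (d (y : L_over) : L)).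
  move=> a y z; pose c : subvs_of F := a *: 1.
  have cE (w : L) : c *: (w : L_over) = a *: w.
    by rewrite fieldOver_scaleE linearZ /= algid1 -scalerAl mul1r.
  by rewrite -!cE; apply: (linearP d).
pose dL : {linear L -> L} :=
  HB.pack (fun y : L => (d (y : L_over) : L)) (GRing.isLinear.Build _ _ _ _ _ d_lin).
exact: (lfunE dL).
Qed.

End Decomposition.

(* Main.v *)
(* A separable element commutes with every differential operator, so L is purely
   inseparable over L_dif; L is separable over L^G; hence L = L^G L_dif.  Since
   G preserves L_dif, Artin's shortening argument shows that L^G and L_dif are
   linearly disjoint over F.  Under L = L^G (x)_F L_dif, an automorphism of L is
   id (x) its restriction to L_dif, and conversely id (x) h is an automorphism of
   L for every h in G(L_dif/F), which matches the operators a b g with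
   a in L^G, b in L_dif on the two sides. *)
From HB Require Import structures.
Require Import Defs.
From mathcomp Require Import all_boot all_order all_fingroup all_algebra.
From mathcomp Require Import all_solvable all_field.
From mathcomp Require Import boolp ring.

Set Implicit Arguments.
Unset Strict Implicit.
Unset Printing Implicit Defensive.

Import GRing.Theory.
Local Open Scope ring_scope.

(** * Automorphisms of [L] over [K] and differential operators *)

Section Automorphisms.
Variables (K : fieldType) (L : fieldExtType K).
Implicit Types (g d : 'End(L)) (x y z l : L).

Lemma amullE l z : amull l z = l * z.
Proof. by rewrite lfunE. Qed.

Lemma is_autP g : reflect (monoid_morphism g) (is_aut g).
Proof. by rewrite /is_aut inE kAutfE; apply: kHom_monoid_morphism. Qed.

Lemma is_aut_ker0 g : is_aut g -> lker g == 0%VS.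
Proof.
move=> /is_autP[g1 gM]; rewrite -subv0; apply/subvP=> x.
rewrite memv_ker memv0; apply: contraTT => x0.
apply: contra_neqN (oner_neq0 L) => /eqP gx0.
by rewrite -g1 -(mulfV x0) gM gx0 mul0r.
Qed.

Lemma is_aut_inv g : is_aut g -> is_aut g^-1%VF.
Proof.
move=> g_aut; have k0 := is_aut_ker0 g_aut; have /is_autP[g1 gM] := g_aut.
apply/is_autP; split=> [|x y]; apply: (can_inj (lker0_lfunK k0)).
  by rewrite lker0_lfunVK.
by rewrite gM !lker0_lfunVK.
Qed.

Lemma is_aut_comp g h : is_aut g -> is_aut h -> is_aut (g \o h)%VF.
Proof.
move=> /is_autP[g1 gM] /is_autP[h1 hM]; apply/is_autP; split=> [|x y].
  by rewrite lfunE /= h1.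
by rewrite !lfunE /= hM.
Qed.

Lemma is_aut_id : is_aut (\1%VF : 'End(L)).
Proof. by apply/is_autP; split=> [|x y]; rewrite !lfunE. Qed.

(** Conjugation by [g] turns multiplication by [l] into multiplication by [g^-1 l], and the
    commutator of the conjugate of [d] with [l] is the conjugate of the commutator of [d] with
    [g l]; induction on the order follows. *)
Lemma diffop_conj g d :
  is_aut g -> diffop d -> diffop (g^-1 \o d \o g)%VF.
Proof.
move=> g_aut [i di]; exists i; have k0 := is_aut_ker0 g_aut.
have /is_autP[_ gM] := g_aut; have /is_autP[_ gVM] := is_aut_inv g_aut.
elim: i d di => [|i IHi] d /= => [[l ->]|di l].
  exists (g^-1%VF l); apply/lfunP=> z.
  by rewrite !lfunE /= !lfunE /= lfunE /= gVM lker0_lfunK.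
have := IHi _ (di (g l)); congr (diffop_le i _).
apply/lfunP=> z; rewrite !(add_lfunE, opp_lfunE, comp_lfunE, amullE).
by rewrite linearB /= gM gVM lker0_lfunK.
Qed.

(** Since [l] commutes with the conjugate of [d] by [g], conjugating back makes [g l] commute with
    [d]. *)
Lemma dif_field_aut g l : is_aut g -> l \in dif_field L -> g l \in dif_field L.
Proof.
move=> g_aut /mem_dif_field cl; apply/mem_dif_field=> d /(diffop_conj g_aut)/cl.
have k0 := is_aut_ker0 g_aut; have /is_autP[_ gM] := g_aut.
move/lfunP=> {}cl; apply/lfunP=> z; have := congr1 g (cl (g^-1%VF z)).
by rewrite !(comp_lfunE, amullE) !gM !lker0_lfunVK // => ->.
Qed.

(* If [d x - x d] commutes with [x], then [d f(x) - f(x) d = f'(x) (d x - x d)]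
   for every polynomial [f] over K; for [f] the minimal polynomial of a separable
   [x] the left-hand side is zero while f'(x) is not. *)
Lemma separable_commutes_diffop i d x :
    diffop_le i d -> separable_element 1 x -> forall z, d (x * z) = x * d z.
Proof.
move=> di sep_x; elim: i d di => [|i IHi] d /= => [[l ->] z|di z].
  by rewrite !lfunE /= mulrCA.
pose e w := d (x * w) - x * d w.
have eE w : ((d \o amull x) - (amull x \o d))%VF w = e w.
  by rewrite !(add_lfunE, opp_lfunE, comp_lfunE, amullE).
(* The commutator [e] has order at most [i], so the induction hypothesis applies to it. *)
have ex w : e (x * w) = x * e w by rewrite -!eE IHi.
have eK a w : e (a *: w) = a *: e w by rewrite -!eE linearZ.
have taylor (f : {poly L}) : f \is a polyOver 1%VS -> forall w,
    d (f.[x] * w) = f.[x] * d w + f^`().[x] * e w.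
  elim/poly_ind: f => [_|f c IHf fc] w.
    by rewrite deriv0 !horner0 !mul0r linear0 addr0.
  have /polyOverP fc' := fc.
  have /vlineP[a ca] : c \in 1%VS.
    by have := fc' 0%N; rewrite coefD coefMX coefC eqxx add0r.
  have f1 : f \is a polyOver 1%VS.
    by apply/polyOverP=> j; have := fc' j.+1; rewrite coefD coefMX coefC addr0.
  rewrite derivMXaddC !hornerE ca !mulrDl linearD -!scalerAl !mul1r linearZ /=.
  have -> : d (f.[x] * x * w) = f.[x] * (x * d w + e w) + f^`().[x] * (x * e w).
    have <- : d (x * w) = x * d w + e w by rewrite addrC subrK.
    by rewrite -mulrA IHf // ex.
  by ring.
have := taylor _ (minPolyOver 1 x) z.
rewrite minPolyxx !mul0r linear0 add0r => /esym/eqP; rewrite mulf_eq0.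
have := separable_root_der 1 x; rewrite sep_x /= /root => /negPf-> /=.
by rewrite /e subr_eq0 => /eqP.
Qed.

Lemma separable_dif_field x : separable_element 1 x -> x \in dif_field L.
Proof.
move=> sep_x; apply/mem_dif_field=> d [i di]; apply/lfunP=> z.
by rewrite !(comp_lfunE, amullE) (separable_commutes_diffop di).
Qed.

(** * Finite orbits and separability *)

Lemma orbit_seq x :
  exists2 s : seq L, uniq s & forall y, y \in s <-> exists2 g, is_aut g & y = g x.
Proof.
pose conj y := exists2 g, is_aut g & y = g x.
(* Conjugates of [x] are roots of its minimal polynomial over [K], which bounds the length of a
   duplicate-free list of them; a longest such list is the whole orbit. *)
pose ok n := `[< exists s, [/\ uniq s, {in s, forall y, conj y} & size s = n] >].
have ok0 : exists n, ok n by exists 0%N; apply/asboolP; exists [::].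
have okB n : ok n -> (n <= (size (minPoly 1 x)).-1)%N.
  case/asboolP=> s [Us sC <-]; rewrite -ltnS prednK ?size_minPoly //.
  rewrite -size_minPoly max_poly_roots ?monic_neq0 ?monic_minPoly //.
  apply/allP=> _ /sC[g /kHom_kAut_sub g_aut ->].
  by apply: (kHom_root_id _ g_aut); rewrite ?subvf ?minPolyOver ?memvf ?root_minPoly.
case: (ex_maxnP ok0 okB) => n /asboolP[s [Us sC sz]] maxn; exists s => // y.
split=> [/sC //|Cy]; apply: contraT => ys.
have /maxn : ok (size s).+1.
  apply/asboolP; exists (y :: s); split=> //=; first by rewrite ys.
  by move=> z; rewrite inE => /predU1P[->|/sC].
by rewrite sz ltnn.
Qed.

Lemma separable_over_fixed x : separable_element (fixed_field L) x.
Proof.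
have [s Us sP] := orbit_seq x; apply/separable_elementP.
exists (\prod_(y <- s) ('X - y%:P)); split; last 1 first.
- by rewrite separable_prod_XsubC.
- apply/polyOverP=> i; apply/mem_fixed_field=> g g_aut.
  have /is_autP gM := g_aut.
  (* Packed as a ring morphism, [g] can be applied to the coefficients of the orbit polynomial. *)
  pose gR : {rmorphism L -> L} :=
    HB.pack (g : L -> L) (GRing.isZmodMorphism.Build _ _ (g : L -> L) (raddfB g))
      (GRing.isMonoidMorphism.Build _ _ (g : L -> L) gM).
  rewrite -[g _]/(gR _) -coef_map rmorph_prod.
  congr (polyseq _)`_i; rewrite (eq_bigr (fun y => 'X - (g y)%:P)); last first.
    move=> y _.
    by rewrite rmorphB [X in X - _](map_polyX gR) [X in _ - X](map_polyC gR).
  rewrite -(big_map g predT (fun y => 'X - y%:P)).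
  apply: perm_big.
  (* The injective map [g] sends the orbit into itself, hence permutes it and fixes the
     coefficients. *)
  have Ugs : uniq (map g s).
    by rewrite map_inj_uniq //; apply/lker0P/is_aut_ker0.
  have sub : {subset map g s <= s}.
    move=> _ /mapP[y /sP[h h_aut ->] ->]; apply/sP.
    by exists (g \o h)%VF; rewrite ?lfunE //; apply: is_aut_comp.
  by apply: uniq_perm => //; case: (uniq_min_size Ugs sub); rewrite ?size_map.
- rewrite root_prod_XsubC; apply/sP; exists \1%VF; first exact: is_aut_id.
  by rewrite lfunE.
Qed.

(* L is separable over L^G, as the orbit of x under G gives a separable
   polynomial with root x, and purely inseparable over L_dif. *)
Lemma fixed_dif_full : (fixed_field L * dif_field L = {:L})%VS.
Proof.
apply/eqP; rewrite eqEsubv subvf /=; apply/subvP=> x _.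
pose M := (fixed_field L * dif_field L)%AS.
(* An element both separable and purely inseparable over [M] lies in [M]. *)
rewrite -[_ \in _]/(x \in M) -separable_inseparable_element.
apply/andP; split.
  by apply: separable_elementS (separable_over_fixed x); apply: field_subvMr.
apply/purely_inseparable_elementP_pchar.
(* The power [x ^+ n] is separable over [K], so it lies in L_dif. *)
have [n /andP[pn sep]] := separable_exponent_pchar 1 x; exists n => //.
by apply: (subvP (field_subvMl _ _)); apply: separable_dif_field.
Qed.

End Automorphisms.

(** * Linear disjointness of L^G and L_dif over F *)

Section Decomposition.
Variables (K : fieldType) (L : fieldExtType K).

Local Notation F := (fixed_dif_field L).
Local Notation A := (fixed_over L).
Local Notation B := (dif_over L).
Local Notation LF := (L_over L).

Lemma aut_fixed (g : 'End(L)) l : is_aut g -> l \in fixed_field L -> g l = l.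
Proof. by move=> g_aut /mem_fixed_field; apply. Qed.

Lemma mem_fixed_over (x : L) :
  ((x : LF) \in aspaceOver F (fixed_field L)) = (x \in fixed_field L).
Proof. exact: mem_aspaceOver (capvSl _ _) x. Qed.

Lemma mem_dif_over (x : L) :
  ((x : LF) \in aspaceOver F (dif_field L)) = (x \in dif_field L).
Proof. exact: mem_aspaceOver (capvSr _ _) x. Qed.

Lemma fixed_val (a : A) : (vsval a : L) \in fixed_field L.
Proof. by rewrite -mem_fixed_over; apply: subvsP. Qed.

Lemma dif_val (b : B) : (vsval b : L) \in dif_field L.
Proof. by rewrite -mem_dif_over; apply: subvsP. Qed.

Lemma fixed_over_lift (x : L) : x \in fixed_field L -> exists a : A, vsval a = x.
Proof. by rewrite -mem_fixed_over => xA; exists (Subvs xA). Qed.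

Lemma dif_over_lift (x : L) : x \in dif_field L -> exists b : B, vsval b = x.
Proof. by rewrite -mem_dif_over => xB; exists (Subvs xB). Qed.

(* Artin's argument: if a shortest relation is normalised to have a coefficient
   1, then subtracting from it its image under [g] yields a shorter one. *)
Lemma fixed_dif_disjoint (I : finType) (a b : I -> L) :
    (forall i, a i \in fixed_field L) ->
    (forall c : I -> L, (forall i, c i \in F) ->
       \sum_i c i * a i = 0 -> forall i, c i = 0) ->
    (forall i, b i \in dif_field L) -> \sum_i a i * b i = 0 ->
  forall i, b i = 0.
Proof.
move=> aG a_free; have [n] := ubnP #|[pred i | b i != 0]|.
elim: n b => // n IHn b; rewrite ltnS => ltbn bS ab0 i0.
apply/eqP/negPn/negP=> bi0.
pose b1 i := b i / b i0.
have b1S i : b1 i \in dif_field L by rewrite memvM ?memvV.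
have ab1 : \sum_i a i * b1 i = 0.
  by under eq_bigr do rewrite mulrA; rewrite -mulr_suml ab0 mul0r.
have b1F i : b1 i \in F.
  rewrite memv_cap b1S andbT; apply/mem_fixed_field=> g g_aut.
  have /is_autP[g1 gM] := g_aut.
  apply/eqP; rewrite -subr_eq0; apply/eqP; move: i.
  apply: (IHn (fun i => g (b1 i) - b1 i)) => [|i|].
  - apply: leq_trans ltbn; apply/proper_card/properP; split.
      apply/subsetP=> i; rewrite !inE; apply: contraNneq => bi.
      by rewrite /b1 bi mul0r linear0 subr0.
    by exists i0; rewrite !inE // /b1 divff // g1 subrr eqxx.
  - by rewrite memvB // dif_field_aut.
  under eq_bigr do rewrite mulrBr; rewrite sumrB ab1 subr0.
  have : g (\sum_i a i * b1 i) = 0 by rewrite ab1 linear0.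
  rewrite linear_sum => gab; rewrite -[RHS]gab; apply: eq_bigr => i _.
  by rewrite [RHS]gM (aut_fixed g_aut (aG i)).
(* All coefficients [b1 i] now lie in F, so independence of the [a i] makes them vanish, against the
   value 1 at [i0]. *)
have b1a : \sum_i b1 i * a i = 0.
  by rewrite -[RHS]ab1; apply: eq_bigr => i _; rewrite mulrC.
have /eqP := a_free b1 b1F b1a i0.
by rewrite /b1 divff // oner_eq0.
Qed.

(** * Bijectivity of the multiplication map *)

Lemma mul_mapE (a : A) (b : B) : mul_map L (tens a b) = vsval a * vsval b.
Proof.
rewrite /mul_map (tens_liftE (b := fun (a : A) (b : B) => vsval a * vsval b)) //.
  by move=> b' c x y; rewrite linearP mulrDl scalerAl.
by move=> a' c x y; rewrite linearP mulrDr scalerAr.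
Qed.

(** Absorbing each coordinate into its left factor makes every summand a product of an element of
    L^G and one of L_dif, so that additive claims reduce to such products. *)
Lemma mul_map_sum (t : tensor A B) :
  mul_map L t = \sum_i \sum_j
    vsval ((t : 'M_(_, _)) i j *: (vbasis {:A})`_i) * vsval (vbasis {:B})`_j.
Proof.
rewrite lfunE /= /tens_lift_fun; apply: eq_bigr => i _; apply: eq_bigr => j _.
by rewrite scalerAl.
Qed.

(** Each row of [t] gives a coefficient [b i] in L_dif of a basis vector of L^G over F. Disjointness
    kills the [b i], then freeness of the basis of L_dif kills the entries. *)
Lemma mul_map_ker0 : lker (mul_map L) == 0%VS.
Proof.
rewrite -subv0; apply/subvP=> t; rewrite memv_ker memv0 => /eqP t0.
pose b i : B := \sum_j (t : 'M_(_, _)) i j *: (vbasis {:B})`_j.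
have b0 i : vsval (b i) = 0.
  move: i; apply: (@fixed_dif_disjoint _
    (fun i : 'I_(\dim {:A}) => vsval (vbasis {:A})`_i)) => [i|c cF c0 i|i|].
  - exact: fixed_val.
  - have /freeP/(_ (fun i => Subvs (cF i))) := basis_free (vbasisP {:A}).
    move=> /(_ _ i)/(congr1 vsval)/= -> //; apply: val_inj.
    by rewrite /= linear_sum -[RHS]c0; apply: eq_bigr => j _; rewrite linearZ.
  - exact: dif_val.
  rewrite -[RHS]t0 mul_map_sum; apply: eq_bigr => i _.
  rewrite linear_sum mulr_sumr; apply: eq_bigr => j _.
  by rewrite linearZ_LR /= scalerCA.
apply/eqP/matrixP=> i j; rewrite mxE.
have /freeP/(_ ((t : 'M_(_, _)) i)) := basis_free (vbasisP {:B}).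
by apply; apply: val_inj; apply: b0.
Qed.

(** The image is a space over F while [fixed_dif_full] speaks of spaces over [K]; the image is
    recast as a [K]-space [U], a scalar [a] of [K] acting as the element [a *: 1] of F. *)
Lemma mul_map_surj (x : LF) : x \in limg (mul_map L).
Proof.
have [] := @vspace_of_pred K L (fun y : L => (y : LF) \in limg (mul_map L)).
- exact: mem0v.
- move=> a y z yI zI; pose c : subvs_of F := a *: 1.
  have -> : a *: y = c *: (y : LF).
    by rewrite fieldOver_scaleE linearZ /= algid1 -scalerAl mul1r.
  by apply: memvD => //; apply: memvZ.
move=> U UP; have /subvP sU : (fixed_field L * dif_field L <= U)%VS; last first.
  by apply/UP/sU; rewrite fixed_dif_full; apply: memvf.
apply/prodvP=> a b.
move=> /fixed_over_lift[a' <-] /dif_over_lift[b' <-]; apply/UP.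
by rewrite -mul_mapE memv_img ?memvf.
Qed.

Lemma mul_mapK : cancel (mul_map L) (mul_map L)^-1%VF.
Proof. exact/lker0_lfunK/mul_map_ker0. Qed.

Lemma mul_map_bij : bijective (mul_map L).
Proof.
exists (mul_map L)^-1%VF; first exact: mul_mapK.
by move=> x; rewrite limg_lfunVK ?mul_map_surj.
Qed.

(** * Operators over F, determined by their values on products *)

Lemma end_over_eq (f g : 'End(LF)) :
    (forall (a : A) (b : B), f (vsval a * vsval b) = g (vsval a * vsval b)) ->
  f = g.
Proof.
move=> fg; apply/lfunP=> x; have /memv_imgP[t _ ->] := mul_map_surj x.
rewrite -!comp_lfunE; move: t; apply/lfunP/tens_hom_eq => a b.
by rewrite !comp_lfunE mul_mapE fg.
Qed.

Lemma tens_endE (phi : 'End(A)) (psi : 'End(B)) a b :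
  tens_end phi psi (vsval a * vsval b) = vsval (phi a) * vsval (psi b).
Proof.
by rewrite !comp_lfunE -(mul_mapE a b) mul_mapK tens_mapE mul_mapE. Qed.

Lemma tens_endDr phi psi1 psi2 :
  tens_end phi (psi1 + psi2) = tens_end phi psi1 + tens_end phi psi2 :> 'End(LF).
Proof.
apply: end_over_eq => a b.
rewrite [RHS]add_lfunE [LHS]tens_endE [X in _ = X + _]tens_endE.
by rewrite [X in _ = _ + X]tens_endE -mulrDr [X in _ * vsval X]add_lfunE.
Qed.

Lemma tens_end0r phi : tens_end phi 0 = 0 :> 'End(LF).
Proof.
by apply: end_over_eq => a b; rewrite tens_endE !zero_lfunE linear0 mulr0.
Qed.

Lemma end_over_inclD (f g : 'End(LF)) :
  end_over_incl (f + g) = end_over_incl f + end_over_incl g.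
Proof. by apply/lfunP=> x; rewrite add_lfunE !end_over_inclE add_lfunE. Qed.

Lemma end_over_incl0 : end_over_incl (0 : 'End(LF)) = 0.
Proof. by apply/lfunP=> x; rewrite end_over_inclE !zero_lfunE. Qed.

(** * Restriction of automorphisms to L_dif and extension from it *)

Lemma dif_restrict (g : 'End(L)) : is_aut g ->
  exists2 h : 'End(B), is_aut h & forall b, vsval (h b) = g (vsval b) :> L.
Proof.
move=> g_aut; have /is_autP[g1 gM] := g_aut.
(* The projection only changes the type: [g] preserves L_dif. Linearity over F holds because F lies
   in L^G. *)
pose h0 (b : B) : B := vsproj (aspaceOver F (dif_field L)) (g (vsval b)).
have h0E b : vsval (h0 b) = g (vsval b) :> L.
  have := dif_field_aut g_aut (dif_val b); rewrite -mem_dif_over => gB.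
  exact: vsprojK gB.
have h0_lin : linear h0.
  move=> c x y; apply: val_inj; rewrite /= !h0E /=.
  have /memv_capP[cG _] := subvsP c.
  have gc : g (vsval c * (vsval x : L)) = vsval c * g (vsval x).
    by rewrite gM (aut_fixed g_aut cG).
  by rewrite [LHS](linearD g) [X in X + _]gc.
pose hL : {linear B -> B} := HB.pack h0 (GRing.isLinear.Build _ _ _ _ _ h0_lin).
have hE b : vsval (linfun hL b) = g (vsval b) :> L by rewrite lfunE h0E.
exists (linfun hL) => //; apply/is_autP; split=> [|x y]; apply: val_inj.
  by rewrite /= hE /= algid1 g1.
by rewrite /= !hE /= gM.
Qed.

Lemma dif_extend (h : 'End(B)) : is_aut h ->
  is_aut (end_over_incl (tens_end \1 h)).
Proof.
move=> /is_autP[h1 hM].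
have (a : A) (b : B) :
    tens_end \1 h (vsval a * vsval b) = vsval a * vsval (h b).
  by rewrite tens_endE id_lfunE.
move: (tens_end _ _) => T TE.
(* Multiplicativity is gained one factor at a time: first with a product on the left and any [y],
   then, by commutativity, with both factors arbitrary. *)
have TM1 (a : A) (b : B) (y : LF) : T (vsval a * vsval b * y) = T (vsval a * vsval b) * T y.
  suffices /lfunP/(_ y) : (T \o amull (vsval a * vsval b) =
      amull (T (vsval a * vsval b)) \o T)%VF by rewrite !comp_lfunE !amullE.
  apply: end_over_eq => c d; rewrite !comp_lfunE !amullE mulrACA.
  by rewrite [LHS](TE (a * c) (b * d)) hM !TE [RHS]mulrACA.
have TM (x y : LF) : T (x * y) = T x * T y.
  suffices /lfunP/(_ y) : (T \o amull x = amull (T x) \o T)%VF.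
    by rewrite !comp_lfunE !amullE.
  by apply: end_over_eq => c d; rewrite !comp_lfunE !amullE mulrC TM1 mulrC.
apply/is_autP; split=> [|x y]; rewrite !end_over_inclE ?TM //.
by have := TE 1 1; rewrite h1 /= !algid1 mul1r => T1; exact: T1.
Qed.

(** * Comparison of the two algebras *)

Lemma skew_alg_add (E : fieldType) (M : fieldExtType E) (d e : 'End(M)) :
  skew_alg d -> skew_alg e -> skew_alg (d + e).
Proof.
move=> [s sA ->] [r rA ->]; exists (s ++ r); first by rewrite all_cat sA.
by rewrite big_cat.
Qed.

Lemma skew_alg0 (E : fieldType) (M : fieldExtType E) : skew_alg (0 : 'End(M)).
Proof. by exists [::]; rewrite ?big_nil. Qed.

Lemma fixed_tens_skew_add (d e : 'End(LF)) :
  fixed_tens_skew d -> fixed_tens_skew e -> fixed_tens_skew (d + e).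
Proof.
move=> [s sA ->] [r rA ->]; exists (s ++ r); last by rewrite big_cat.
by move=> u; rewrite mem_cat => /orP[/sA|/rA].
Qed.

(** The operator a (x) (b h) equals multiplication by a b after id (x) h, and the latter is an
    automorphism of [L] by [dif_extend]. *)
Lemma skew_alg_tens (a : A) (psi : 'End(B)) :
  skew_alg psi -> skew_alg (end_over_incl (tens_end (amull a) psi)).
Proof.
case=> s + ->; elim: s => [_|[b h] s IHs /= /andP[h_aut sA]].
  by rewrite big_nil tens_end0r end_over_incl0; apply: skew_alg0.
rewrite big_cons tens_endDr end_over_inclD; apply: skew_alg_add; last exact: IHs.
exists [:: (vsval a * vsval b : L, end_over_incl (tens_end \1 h))].
  by rewrite /= dif_extend.
rewrite big_seq1 /=.
have -> : tens_end (amull a) (amull b \o h) =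
    (amull (vsval a * vsval b) \o tens_end \1 h)%VF :> 'End(LF).
  apply: end_over_eq => c d.
  rewrite [LHS]tens_endE [RHS]comp_lfunE [RHS]amullE.
  rewrite [X in _ = _ * X]tens_endE comp_lfunE !amullE id_lfunE.
  exact: mulrACA.
apply/lfunP=> x.
by rewrite [RHS]comp_lfunE amullE !end_over_inclE comp_lfunE amullE.
Qed.

(** By additivity [l] may be taken to be a product a b; then (a b) g is a (x) (b h), with [h] the
    restriction of [g] to L_dif. *)
Lemma skew_alg_fixed_tens (l : L) (g : 'End(L)) : is_aut g ->
  exists2 t : 'End(LF), fixed_tens_skew t & (amull l \o g)%VF = end_over_incl t.
Proof.
move=> g_aut; have [h h_aut hE] := dif_restrict g_aut.
have /is_autP[_ gM] := g_aut.
pose P (x : L) := exists2 t : 'End(LF), fixed_tens_skew t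
  & (amull x \o g)%VF = end_over_incl t.
have PD x y : P x -> P y -> P (x + y).
  move=> [t tS xt] [u uS yu]; exists (t + u); first exact: fixed_tens_skew_add.
  by rewrite linearD comp_lfunDl xt yu end_over_inclD.
have P0 : P 0.
  exists 0; first by exists [::]; rewrite ?big_nil.
  by rewrite linear0 comp_lfun0l end_over_incl0.
have /memv_imgP[t _ ->] := mul_map_surj l.
rewrite mul_map_sum; elim/big_ind: _ => // i _; elim/big_ind: _ => // j _.
move: (_ *: _) (_`_j) => a b.
exists (tens_end (amull a) (amull b \o h)%VF).
  exists [:: (a, (amull b \o h)%VF)]; last by rewrite big_seq1.
  move=> _ /[!inE]/eqP-> /=; exists [:: (b, h)]; last by rewrite big_seq1.
  by rewrite /= h_aut.
apply/lfunP=> x; rewrite comp_lfunE amullE end_over_inclE.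
(* The left side is only an operator over [K], outside the scope of [end_over_eq], so [x] is
   expanded into products directly. *)
have /memv_imgP[u _ ->] := mul_map_surj x; rewrite mul_map_sum.
elim/big_ind: _ => [|y z Py Pz|k _]; first by rewrite !linear0 mulr0.
  by rewrite !linearD mulrDr Py Pz.
elim/big_ind: _ => [|y z Py Pz|m _]; first by rewrite !linear0 mulr0.
  by rewrite !linearD mulrDr Py Pz.
move: (_ *: _) (_`_m) => c d.
rewrite [RHS]tens_endE comp_lfunE !amullE gM -hE [RHS]mulrACA.
by rewrite (aut_fixed g_aut (fixed_val c)).
Qed.

Lemma skew_algP (d : 'End(L)) :
  skew_alg d <-> exists2 t : 'End(LF), fixed_tens_skew t & d = end_over_incl t.
Proof.
split=> [[s + ->]|[_ [s sS ->] ->]]; last first.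
  elim: s sS => [_|[a psi] s IHs sS].
    by rewrite big_nil end_over_incl0; apply: skew_alg0.
  rewrite big_cons end_over_inclD; apply: skew_alg_add.
    by apply/skew_alg_tens/(sS (a, psi)); rewrite mem_head.
  by apply: IHs => u us; apply: sS; rewrite inE us orbT.
elim: s => [_|[l g] s IHs /= /andP[g_aut sA]].
  by exists 0; [exists [::]; rewrite ?big_nil | rewrite big_nil end_over_incl0].
have [t tS lg] := skew_alg_fixed_tens l g_aut; have [u uS su] := IHs sA.
exists (t + u); first exact: fixed_tens_skew_add.
by rewrite big_cons lg su end_over_inclD.
Qed.

End Decomposition.

Theorem proposition5p23 (p : nat) (K : fieldType) (L : fieldExtType K)
    (charKp : p \in [pchar K]) :
  bijective (mul_map L) /\
  forall d : 'End(L),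
    skew_alg d <->
    exists2 t : 'End(L_over L), fixed_tens_skew t & d = end_over_incl t.
Proof. by split; [exact: mul_map_bij | exact: skew_algP]. Qed.
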